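(* For every $t\in\mathbb{Z}_+$, $$d_t\ge\frac12\left(1-\frac{2\pi}{N}\right)\lambda(L_0)^t.$$
   Context: Let $N\in 4\mathbb{N}$, let $\mathcal{S}_N=\{0,\dots,N\}$, and let $J_0,J_N\in\{3,5,\dots,N-3\}$ (odd integers). Put $\nu_0=\delta_{J_0}$, $\nu_N=\delta_{J_N}$ (point masses). The transition function $p$ on $\mathcal{S}_N$ is $$p(x,y)=\begin{cases}\frac12 & x=y\\ \frac14 & |x-y|=1\\ \frac14\nu_x(y) & x\in\{0,N\},\ |y-x|>1\end{cases}$$ and $p(x,y)=0$ otherwise. (So from $0$ the chain jumps to $J_0$ with probability $\frac14$, and from $N$ it jumps to $J_N$ with probability $\frac14$.) For $x\in\mathcal{S}_N$, $P_x$ is the law under which $X=(X_n)_{n\in\mathbb{Z}_+}$ is a Markov chain with transition function $p$ and $X_0=x$. For $t\in\mathbb{Z}_+$ let $$d_t(x,y)=\max_{A\subset\mathcal{S}_N}\left(P_x(X_t\in A)-P_y(X_t\in A)\right),\qquad d_t=\sup_{x,y\in\mathcal{S}_N}d_t(x,y).$$ Define $$L_0=\tfrac12\max\{J_0-1,\;N-1-J_N,\;N+J_N-J_0\},\qquad \lambda(L)=\tfrac12\left(\cos\left(\frac{\pi}{L+1}\right)+1\right).$$ *)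

(* Defs.v *)
From HB Require Import structures.
From mathcomp Require Import all_boot all_order all_algebra.
From mathcomp Require Import all_classical all_reals all_analysis.

Set Implicit Arguments.
Unset Strict Implicit.
Unset Printing Implicit Defensive.

Import Order.TTheory GRing.Theory Num.Theory IntDist.
Import numFieldNormedType.Exports.
Local Open Scope classical_set_scope.
Local Open Scope ring_scope.

(* The state space {0, ..., N} is 'I_N.+1, with the discrete sigma-algebra. *)
HB.instance Definition _ (N : nat) := isPointed.Build 'I_N.+1 ord0.
HB.instance Definition _ (N : nat) := @isMeasurable.Build
  default_measure_display 'I_N.+1 (@discrete_measurable 'I_N.+1)
  (@discrete_measurable0 'I_N.+1) (@discrete_measurableC 'I_N.+1)
  (@discrete_measurableU 'I_N.+1).

Section JumpChain.
Context {R : realType} (N J0 JN : nat).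

(* Only used for x = 0 (point mass at J0) and x = N (point mass at JN). *)
Definition nu (x y : 'I_N.+1) : R :=
  if x == ord0 then (y == J0 :> nat)%:R else (y == JN :> nat)%:R.

(* The third branch is reached only when |x - y| > 1. *)
Definition jump_trans (x y : 'I_N.+1) : R :=
  if x == y then 1 / 2
  else if `|x - y|%N == 1%N then 1 / 4
  else if (x == ord0) || (x == ord_max) then 1 / 4 * nu x y
  else 0.

(* The subtractions and the halving are those of R, not of nat. *)
Definition L0 : R :=
  1 / 2 * Num.max (J0%:R - 1)
            (Num.max (N%:R - 1 - JN%:R) (N%:R + JN%:R - J0%:R)).

End JumpChain.

Definition lambda {R : realType} (L : R) : R :=
  1 / 2 * (cos (pi / (L + 1)) + 1).

Section MarkovChain.
Context {R : realType} {d : measure_display} {Omega : measurableType d}.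

(* Meaningful only when [P A] is nonzero. *)
Definition cond_prob (P : probability Omega R) (B A : set Omega) : R :=
  fine (P (A `&` B)) / fine (P A).

Context {N : nat}.
Implicit Types (X : nat -> {mfun Omega >-> 'I_N.+1}) (p : 'I_N.+1 -> 'I_N.+1 -> R).

(* The values of s beyond time n are irrelevant. *)
Definition history X (n : nat) (s : nat -> 'I_N.+1) : set Omega :=
  [set w | forall i, (i <= n)%N -> X i w = s i].

Definition is_markov_chain (P : probability Omega R) X p : Prop :=
  forall (n : nat) (s : nat -> 'I_N.+1) (y : 'I_N.+1),
    P (history X n s) != 0%E ->
    cond_prob P (X n.+1 @^-1` [set y]) (history X n s) = p (s n) y.

Definition markov_chain_from (P : probability Omega R) X p (x : 'I_N.+1) : Prop :=
  is_markov_chain P X p /\ P (X 0%N @^-1` [set x]) = 1%E.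

Implicit Type P : 'I_N.+1 -> probability Omega R.

(* The default value 0 of the maximum is attained at A = set0. *)
Definition dist_at P X (t : nat) (x y : 'I_N.+1) : R :=
  \big[Num.max/0]_(A : {set 'I_N.+1})
    (fine (P x (X t @^-1` [set` A])) - fine (P y (X t @^-1` [set` A]))).

Definition dist_sup P X (t : nat) : R :=
  sup [set dist_at P X t x y | x in [set: 'I_N.+1] & y in [set: 'I_N.+1]].

End MarkovChain.

(* Main.v *)
Require Import Defs.
From HB Require Import structures.
From mathcomp Require Import all_boot all_order all_algebra.
From mathcomp Require Import all_classical all_reals all_analysis.
From mathcomp Require Import zify ring lra.
Import Order.TTheory GRing.Theory Num.Theory.
Local Open Scope ring_scope.

(** The bound holds because [lambda (L0 N J0 JN)] is an eigenvalue of the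
transition function with a real, nonconstant eigenfunction [f].  If [f] is
maximal at [x] and minimal at [y], then the expectations of [f (X t)] from [x]
and from [y] differ by [lambda ^+ t * (f x - f y)], while a difference of
expectations of [f] is at most the total variation distance times the
oscillation [f x - f y].  Dividing gives [lambda ^+ t <= dist_sup P X t]
([eigen_le_dist_sup]), which implies the claim since the constant
[1 / 2 * (1 - 2 * pi / N)] is less than 1.

The eigenfunction is [f x = cos (theta * (x - c))], restricted from the real
line.  Extended to [-1] and [N + 1] it satisfies
[f (x - 1) + f (x + 1) = 2 * cos theta * f x] everywhere, so the jump from
[0] to [J0], which stands in for a step to [-1], preserves the eigenvalue
equation exactly when [f J0 = f (-1)]; likewise at the other end the condition
is [f JN = f (N + 1)].  Two points have equal cosines when they are a period
apart, or placed symmetrically about [c] up to a period.  The angle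
[theta = pi / (L + 1)] has period [2 * (L + 1)], and each of the three
quantities whose maximum is [L0] is what makes both conditions solvable:
- [2 * (L + 1) = J0 + 1]: [J0] and [-1] are a period apart, and [c] is the
  midpoint of [JN] and [N + 1];
- [2 * (L + 1) = N + 1 - JN]: the mirror image;
- [2 * (L + 1) = N + JN - J0 + 2]: [c] is the midpoint of [-1] and [J0], and
  reflecting [JN] about [c] gives [N + 1] shifted by one period.

The Markov property, given through cylinder events [history X n s], enters
only through [expectation_history], by induction on the number of remaining
steps. *)

(** * Laws of variables with values in the state space *)

Section Fibres.
Context {R : realType} {d : measure_display} {Omega : measurableType d}.
Context {N : nat}.
Implicit Types (P : probability Omega R) (Y : {mfun Omega >-> 'I_N.+1}).
Local Open Scope classical_set_scope.

Lemma measurable_fibre Y (B : set 'I_N.+1) : measurable (Y @^-1` B).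
Proof. exact: measurable_funPTI. Qed.

Lemma measurable_history (X : nat -> {mfun Omega >-> 'I_N.+1}) n s :
  measurable (history X n s).
Proof.
rewrite (_ : history X n s =
  \bigcap_(i in [set i | (i <= n)%N]) (X i @^-1` [set s i])).
  by apply: bigcap_measurableType => i _; exact: measurable_fibre.
by apply/seteqP; split.
Qed.

Lemma prob_fibres P Y (B : {pred 'I_N.+1}) (E : set Omega) : measurable E ->
  fine (P (Y @^-1` [set` B] `&` E)) =
  \sum_(z in B) fine (P (Y @^-1` [set z] `&` E)).
Proof.
move=> mE.
have mF z : measurable (Y @^-1` [set z] `&` E).
  by apply: measurableI => //; exact: measurable_fibre.
rewrite sum_fine; last by move=> z _; exact: fin_num_measure.
congr fine; rewrite -measure_bigsetU_ord //; last first.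
  by move=> i j _ _ [w [[/= Yi _] [/= Yj _]]]; rewrite -Yi -Yj.
congr (P _); rewrite -bigcup_pred; apply/seteqP.
by split => [w [/= YB Ew]|w [z /= zB [Yz Ew]]]; [exists (Y w)|rewrite Yz].
Qed.

Lemma prob_fibres_total P Y (E : set Omega) : measurable E ->
  \sum_z fine (P (Y @^-1` [set z] `&` E)) = fine (P E).
Proof.
move=> mE; rewrite -(@prob_fibres P Y predT) //; congr (fine (P _)).
by apply/seteqP; split => [w []|w].
Qed.

End Fibres.

(** * Eigenfunctions of a transition function *)

Section Eigen.
Context {R : realType} {d : measure_display} {Omega : measurableType d}.
Context {N : nat} (X : nat -> {mfun Omega >-> 'I_N.+1}).
Context (p : 'I_N.+1 -> 'I_N.+1 -> R) (f : 'I_N.+1 -> R) (lam : R).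
Hypothesis pf : forall x, \sum_y p x y * f y = lam * f x.
Local Open Scope classical_set_scope.

(** Multiplying out the conditional probability also covers null histories,
where both sides vanish. *)
Lemma history_step (P : probability Omega R) n s y : is_markov_chain P X p ->
  fine (P (X n.+1 @^-1` [set y] `&` history X n s)) =
  fine (P (history X n s)) * p (s n) y.
Proof.
move=> mc.
have mH := measurable_history X n s.
have [H0|H0] := eqVneq (P (history X n s)) 0%E.
  rewrite H0 mul0r (_ : P _ = 0%E) //; apply/eqP.
  rewrite -measure_le0 -H0 le_measure ?inE //.
  by apply: measurableI => //; exact: measurable_fibre.
rewrite -(mc n s y H0) /cond_prob mulrCA divff ?mulr1 1?setIC //.
by rewrite fine_eq0 // fin_num_measure.
Qed.

Lemma history_split n s z :
  X n.+1 @^-1` [set z] `&` history X n s =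
  history X n.+1 (fun i => if i == n.+1 then z else s i).
Proof.
apply/seteqP; split => w /=.
  move=> [Xz Hw] i; rewrite leq_eqVlt; case: eqP => [->//|_ /= lin].
  exact: Hw.
move=> Hw; split=> [|i lin]; first by rewrite /= Hw // eqxx.
by rewrite Hw ?(leqW lin) // ltn_eqF.
Qed.

(** Conditioning on the whole past, and letting the history grow by one step
inside the induction, avoids ever summing over paths: only the next state is
averaged out at each stage. *)
Lemma expectation_history (P : probability Omega R) : is_markov_chain P X p ->
  forall m n s,
  \sum_y f y * fine (P (X (n + m)%N @^-1` [set y] `&` history X n s)) =
  lam ^+ m * f (s n) * fine (P (history X n s)).
Proof.
move=> mc; elim=> [|m IHm] n s.
  rewrite addn0 expr0 mul1r (bigD1 (s n)) //= big1 ?addr0 => [|y /eqP ysn].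
    congr (_ * fine (P _)); apply/seteqP; split => [w [] //|w Hw].
    by split => //; exact: Hw.
  rewrite (_ : _ `&` _ = set0) ?measure0 ?mulr0 //.
  by apply/seteqP; split => // w [/= Xy /(_ n (leqnn n))]; rewrite Xy.
have mH := measurable_history X n s.
under eq_bigr => y _.
  rewrite -(prob_fibres_total P (X n.+1)); last first.
    by apply: measurableI => //; exact: measurable_fibre.
  rewrite mulr_sumr.
  under eq_bigr => z _ do rewrite setICA history_split -addSnnS.
  over.
rewrite exchange_big /=.
under eq_bigr => z _ do
  rewrite IHm eqxx -history_split history_step // mulrCA -!mulrA.
rewrite -!mulr_sumr.
under eq_bigr => z _ do rewrite [f z * _]mulrC.
rewrite pf exprS; ring.
Qed.

Lemma expectation_from (P : probability Omega R) x t :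
  markov_chain_from P X p x ->
  \sum_y f y * fine (P (X t @^-1` [set y])) = lam ^+ t * f x.
Proof.
move=> [mc X0x].
have HX : history X 0 (fun=> x) = X 0%N @^-1` [set x].
  apply/seteqP; split => [w Hw|w Xw i]; first exact: Hw.
  by rewrite leqn0 => /eqP ->.
have := expectation_history P mc t 0 (fun=> x).
rewrite HX X0x mulr1 => <-; apply: eq_bigr => y _; congr (_ * _).
have mf z n := measurable_fibre (X n) [set z].
rewrite -(prob_fibres_total P (X 0%N)); last exact: mf.
rewrite (bigD1 x) //= big1 ?addr0 ?add0n 1?setIC// => z zx.
rewrite (_ : P _ = 0%E) //; apply/eqP.
rewrite -measure_le0 (_ : 0%E = P (~` (X 0%N @^-1` [set x]))).
  rewrite le_measure ?inE //.
  - exact: measurableI.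
  - exact: measurableC.
  by move=> w [/= -> _]; apply/eqP.
by rewrite probability_setC // [X in (_ - X)%E]X0x subee.
Qed.

(** Duality between total variation and oscillation: the test event is where
the law from [x] exceeds the law from [y]. *)
Lemma eigen_le_dist_at (P : 'I_N.+1 -> probability Omega R) x y t :
  (forall z, markov_chain_from (P z) X p z) ->
  (forall z, f y <= f z <= f x) -> f y < f x ->
  lam ^+ t <= dist_at P X t x y.
Proof.
move=> mc fyx lt_yx.
pose mu v z := fine (P v (X t @^-1` [set z])).
have mu_set v (A : {pred 'I_N.+1}) :
    fine (P v (X t @^-1` [set` A])) = \sum_(z in A) mu v z.
  rewrite -[in LHS](setIT (_ @^-1` _)) prob_fibres //.
  by under eq_bigr do rewrite setIT.
have mu1 v : \sum_z mu v z = 1.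
  rewrite /mu; under eq_bigr do rewrite -(setIT (_ @^-1` _)).
  by rewrite prob_fibres_total // probability_setT.
pose A := [set z | mu y z < mu x z]%SET.
apply: (@le_trans _ _
  (fine (P x (X t @^-1` [set` A])) - fine (P y (X t @^-1` [set` A])))).
  rewrite !mu_set -sumrB -(@ler_pM2r _ (f x - f y)) ?subr_gt0 //.
  rewrite mulrBr -!(expectation_from _ _ t (mc _)) -sumrB.
  (* Both laws have mass 1, so f may be shifted by the constant f y. *)
  have -> : \sum_z (f z * mu x z - f z * mu y z) =
            \sum_z (f z - f y) * (mu x z - mu y z).
    apply/eqP; rewrite -subr_eq0 -sumrB.
    rewrite (eq_bigr (fun z => f y * mu x z - f y * mu y z)); last first.
      by move=> z _; ring.
    by rewrite sumrB -!mulr_sumr !mu1 subrr.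
  (* The weights f z - f y lie in [0, f x - f y]: off A the terms are
     nonpositive, on A they grow when the weight is replaced by its maximum. *)
  rewrite mulr_suml [leRHS]big_mkcond /=; apply: ler_sum => z _.
  have /andP[h1 h2] := fyx z; rewrite inE; case: ltP => hmu; nra.
rewrite /dist_at.
exact: (@le_bigmax_cond _ _ _ _ _ predT
  (fun A : {set 'I_N.+1} =>
     fine (P x (X t @^-1` [set` A])) - fine (P y (X t @^-1` [set` A])))).
Qed.

Lemma dist_at_le_sup (P : 'I_N.+1 -> probability Omega R) x y t :
  dist_at P X t x y <= dist_sup P X t.
Proof.
apply: ub_le_sup; last by exists x => //; exists y.
exists 1 => _ [u _ [v _ <-]]; apply: bigmax_le => // A _.
have mA := measurable_fibre (X t) [set` A].
rewrite lerBlDr (@le_trans _ _ 1) ?lerDl ?fine_ge0 //.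
by rewrite -lee_fin fineK ?fin_num_measure ?probability_le1.
Qed.

Lemma eigen_le_dist_sup (P : 'I_N.+1 -> probability Omega R) t :
  (forall z, markov_chain_from (P z) X p z) ->
  (exists u v, f u != f v) ->
  lam ^+ t <= dist_sup P X t.
Proof.
move=> mc [u [v fuv]].
have [x _ xmax] := @arg_maxP _ _ _ ord0 predT f isT.
have [y _ ymin] := @arg_minP _ _ _ ord0 predT f isT.
apply: le_trans (dist_at_le_sup P x y t).
apply: eigen_le_dist_at => [//|z|].
  by apply/andP; split; [exact: ymin|exact: xmax].
rewrite lt_neqAle; apply/andP; split; last exact: ymin.
apply: contra_neq fuv => fyx.
have fc z : f z = f x.
  apply/eqP; rewrite eq_le; apply/andP; split; first exact: xmax.
  by rewrite -fyx; exact: ymin.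
by rewrite !fc.
Qed.

End Eigen.

(** * Cosines on an interval of integers *)

(** The three points 0, 1, 2 suffice: the relation between consecutive values
forces a constant value to be 0, and a cosine and its shift by [theta] both
vanish only when [sin theta = 0]. *)
Lemma cos_nonconstant {R : realType} (N : nat) (theta c : R) :
  (1 < N)%N -> sin theta != 0 ->
  exists u v : 'I_N.+1,
    cos (theta * (u%:R - c)) != cos (theta * (v%:R - c)).
Proof.
move=> N1 sin0; apply: contrapT => /forallNP Hc.
have fc (k l : nat) : (k <= N)%N -> (l <= N)%N ->
    cos (theta * (k%:R - c)) = cos (theta * (l%:R - c)).
  move=> kN lN; apply/eqP; apply: contrapT => /negP kl.
  apply: (Hc (Ordinal (kN : (k < N.+1)%N))).
  by exists (Ordinal (lN : (l < N.+1)%N)).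
have f01 : cos (theta * (0%:R - c)) = cos (theta * (1%:R - c)) by apply: fc; lia.
have f21 : cos (theta * (2%:R - c)) = cos (theta * (1%:R - c)) by apply: fc; lia.
move: f01 f21.
rewrite (_ : theta * (0%:R - c) = theta * (1%:R - c) - theta); last by ring.
rewrite (_ : theta * (2%:R - c) = theta * (1%:R - c) + theta); last by ring.
move: (theta * (1%:R - c)) => a; rewrite cosB cosD => h1 h2.
have := cos2Dsin2 a; have := cos2Dsin2 theta.
have sa : sin a = 0.
  have /eqP : sin a * sin theta = 0 by lra.
  by rewrite mulf_eq0 (negPf sin0) orbF => /eqP.
have ca : cos a * (cos theta - 1) = 0 by lra.
move/eqP: ca; rewrite mulf_eq0 => /orP[/eqP ->|/eqP c1 e1 _].
  by rewrite sa => _ /eqP; rewrite expr0n addr0 eq_sym oner_eq0.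
case/eqP: sin0; apply/eqP; rewrite -sqrf_eq0; apply/eqP.
have {}c1 : cos theta = 1 by lra.
by move: e1; rewrite c1 expr1n; lra.
Qed.

Lemma cos_sum_2pi {R : realType} (a b : R) : a + b = 2 * pi -> cos a = cos b.
Proof.
move=> ab; have -> : a = - b + pi *+ 2 by rewrite -mulr_natl; lra.
by rewrite cosD2pi cosN.
Qed.

Lemma cos_sub_2pi {R : realType} (a b : R) : a - b = 2 * pi -> cos a = cos b.
Proof.
move=> ab; have -> : a = b + pi *+ 2 by rewrite -mulr_natl; lra.
by rewrite cosD2pi.
Qed.

Lemma cos_sum_0 {R : realType} (a b : R) : a + b = 0 -> cos a = cos b.
Proof. by move=> /eqP; rewrite addr_eq0 => /eqP ->; rewrite cosN. Qed.

(** * Cosine eigenfunctions of the jump chain *)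

Section JumpEigen.
Context {R : realType} (N J0 JN : nat).
Hypothesis hJ0 : (3 <= J0 <= N - 3)%N.
Hypothesis hJN : (3 <= JN <= N - 3)%N.

(** Since both jump targets are at distance at least 3 from either end, the
branches of the definition never overlap and add up as indicators. *)
Lemma jump_transE (x y : 'I_N.+1) : jump_trans (R := R) J0 JN x y =
  1 / 2 * (y == x :> nat)%:R + 1 / 4 * (y == x.+1 :> nat)%:R
  + 1 / 4 * ((0 < x)%N && (y == x.-1 :> nat))%:R
  + 1 / 4 * ((x == 0 :> nat) && (y == J0 :> nat))%:R
  + 1 / 4 * ((x == N :> nat) && (y == JN :> nat))%:R.
Proof.
rewrite /jump_trans /nu -!val_eqE /=.
have := ltn_ord x; have := ltn_ord y.
move: (val x) (val y) => {x y} a b hb ha.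
have -> : (`|a%:Z - b%:Z|%N == 1%N) = (b == a.+1) || ((0 < a)%N && (b == a.-1)).
  by lia.
do ![case: eqP => ?]; do ?case: ltnP => ?; rewrite /=; first [lia | lra].
Qed.

Lemma sum_point (P : bool) (k : nat) (g : nat -> R) :
  \sum_(y < N.+1) (P && (y == k :> nat))%:R * g y = (P && (k <= N)%N)%:R * g k.
Proof.
case: P => /=; last by rewrite mul0r big1 // => y _; rewrite mul0r.
case: leqP => [kN|Nk].
  rewrite (bigD1 (Ordinal (kN : (k < N.+1)%N))) //= eqxx big1 ?addr0 // => y yk.
  by rewrite -val_eqE /= in yk; rewrite (negPf yk) mul0r.
rewrite mul0r big1 // => y _; case: eqP => [yk|]; last by rewrite mul0r.
by have := ltn_ord y; lia.
Qed.

(** The jump out of an end has the same probability 1/4 as a step to its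
missing neighbour would have, so it acts on [f] as that step does as soon as
the two values of [f] agree. *)
Lemma jump_eigen (f : R -> R) (kap : R) (x : 'I_N.+1) :
  (forall u, f (u - 1) + f (u + 1) = 2 * kap * f u) ->
  f J0%:R = f (-1) -> f JN%:R = f (N%:R + 1) ->
  \sum_y jump_trans J0 JN x y * f y%:R = 1 / 2 * (kap + 1) * f x%:R.
Proof.
move=> harm f0 fN; pose g (k : nat) := f k%:R.
under eq_bigr => y _ do rewrite jump_transE !mulrDl -!mulrA.
rewrite !big_split /= -!mulr_sumr.
rewrite (sum_point true x g) (sum_point true x.+1 g) !(sum_point _ _ g) /=.
have J0N : (J0 <= N)%N by lia.
have JNN : (JN <= N)%N by lia.
have xN : (x <= N)%N by rewrite -ltnS.
have x1N : (x.-1 <= N)%N by lia.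
have := harm x%:R; rewrite /g f0 fN J0N JNN xN x1N !andbT.
move: (nat_of_ord x) xN => {x x1N} k kN.
have [->|k0] := eqVneq k 0%N.
  have -> : (0 < N)%N by lia.
  have -> : (0 == N)%N = false by lia.
  rewrite /= sub0r add0r => h; lra.
have -> : k%:R - 1 = k.-1%:R :> R.
  by rewrite -[in LHS](prednK (n := k)) ?lt0n // -natr1 addrK.
have -> : (0 < k)%N by rewrite lt0n.
have [->|kNe] := eqVneq k N.
  rewrite ltnn /= => h; lra.
have -> : (k < N)%N by lia.
rewrite /= -[k.+1%:R]natr1 => h; lra.
Qed.

Lemma jump_cos_eigen (theta c : R) (x : 'I_N.+1) :
  cos (theta * (J0%:R - c)) = cos (theta * (- 1 - c)) ->
  cos (theta * (JN%:R - c)) = cos (theta * (N%:R + 1 - c)) ->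
  \sum_y jump_trans J0 JN x y * cos (theta * (y%:R - c)) =
  1 / 2 * (cos theta + 1) * cos (theta * (x%:R - c)).
Proof.
apply: (jump_eigen (fun u => cos (theta * (u - c)))) => u.
rewrite (_ : theta * (u - 1 - c) = theta * (u - c) - theta); last by ring.
rewrite (_ : theta * (u + 1 - c) = theta * (u - c) + theta); last by ring.
rewrite cosB cosD; ring.
Qed.

Lemma L0_cases (L := L0 (R := R) N J0 JN) :
  [\/ L = (J0%:R - 1) / 2, L = (N%:R - 1 - JN%:R) / 2
    | L = (N%:R + JN%:R - J0%:R) / 2].
Proof.
rewrite /L /L0 !maxEle.
case: ifP => _; first case: ifP => _.
- by apply: Or33; lra.
- by apply: Or32; lra.
- by apply: Or31; lra.
Qed.

Lemma L0_gt0 : 0 < L0 (R := R) N J0 JN.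
Proof.
rewrite /L0 mulr_gt0 // !lt_max subr_gt0 ltr1n (_ : (1 < J0)%N) //; lia.
Qed.

(** When one of the first two terms realizes [L0], one boundary condition holds
by periodicity for every [c], which is then free to satisfy the other one by
symmetry.  For the third term, symmetry at [0] determines [c], and symmetry
combined with a period gives the condition at [N]. *)
Lemma L0_eigen : exists c : R, forall x : 'I_N.+1,
  let f (y : 'I_N.+1) := cos (pi / (L0 N J0 JN + 1) * (y%:R - c)) in
  \sum_y jump_trans J0 JN x y * f y = lambda (L0 N J0 JN) * f x.
Proof.
have L_gt0 := L0_gt0; have := L0_cases; set L := L0 _ _ _ in L_gt0 *.
move=> LE.
have [c [h0 hN]] : exists c : R,
    cos (pi / (L + 1) * (J0%:R - c)) = cos (pi / (L + 1) * (- 1 - c)) /\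
    cos (pi / (L + 1) * (JN%:R - c)) = cos (pi / (L + 1) * (N%:R + 1 - c)).
  have period (a : R) : a = 2 * (L + 1) -> pi / (L + 1) * a = 2 * pi.
    by move=> ->; field; lra.
  have opposite (a : R) : a = 0 -> pi / (L + 1) * a = 0.
    by move=> ->; rewrite mulr0.
  case: LE => LE.
  - exists ((N%:R + 1 + JN%:R) / 2); split.
      by apply: cos_sub_2pi; rewrite -mulrBr; apply: period; lra.
    by apply: cos_sum_0; rewrite -mulrDr; apply: opposite; lra.
  - exists ((J0%:R - 1) / 2); split.
      by apply: cos_sum_0; rewrite -mulrDr; apply: opposite; lra.
    by apply/esym/cos_sub_2pi; rewrite -mulrBr; apply: period; lra.
  - exists ((J0%:R - 1) / 2); split.
      by apply: cos_sum_0; rewrite -mulrDr; apply: opposite; lra.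
    by apply: cos_sum_2pi; rewrite -mulrDr; apply: period; lra.
by exists c => x; exact: jump_cos_eigen.
Qed.

Lemma sin_L0_neq0 : sin (pi / (L0 (R := R) N J0 JN + 1)) != 0.
Proof.
have L_gt0 := L0_gt0.
apply: lt0r_neq0; apply: sin_gt0_pi; rewrite divr_gt0 ?pi_gt0 //=; last lra.
by rewrite ltr_pdivrMr; [rewrite ltr_pMr ?pi_gt0 //|]; lra.
Qed.

End JumpEigen.

Theorem proposition5 (R : realType) (N J0 JN : nat)
  (hN : (4 %| N)%N)
  (hJ0 : (3 <= J0 <= N - 3)%N) (oJ0 : odd J0)
  (hJN : (3 <= JN <= N - 3)%N) (oJN : odd JN)
  (d : measure_display) (Omega : measurableType d)
  (P : 'I_N.+1 -> probability Omega R)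
  (X : nat -> {mfun Omega >-> 'I_N.+1})
  (hX : forall x : 'I_N.+1,
      markov_chain_from (P x) X (jump_trans (R := R) J0 JN) x)
  (t : nat) :
  1 / 2 * (1 - 2 * pi / N%:R) * lambda (L0 N J0 JN) ^+ t <= dist_sup P X t.
Proof.
have [c eig] := L0_eigen (R := R) N J0 JN hJ0 hJN.
have lam_ge0 : 0 <= lambda (L0 N J0 JN) :> R.
  by rewrite /lambda mulr_ge0 // -lerBlDr sub0r cos_geN1.
apply: (@le_trans _ _ (lambda (L0 N J0 JN) ^+ t)).
  have pN : 0 <= pi / N%:R :> R by rewrite divr_ge0 ?pi_ge0.
  by rewrite ler_piMl ?exprn_ge0 // -mulrA; lra.
apply: (eigen_le_dist_sup X _ _ _ eig) => //.
apply: cos_nonconstant; [lia|exact: sin_L0_neq0].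
Qed.
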